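(* After a suitable rotation, the cuboctahedron in $\mathbb{R}^3$ can be decomposed into two decahedra (convex polytopes with exactly 10 faces) with orthogonally connected boundaries.
   Context: A polygonal path in $\mathbb{R}^3$ is orthogonal if each of its edges is parallel to one of the coordinate axes. A set $S\subset\mathbb{R}^3$ is orthogonally connected if any two distinct points of $S$ are joined by an orthogonal path contained in $S$. A polytope is decomposed into polytopes $P_1,\dots,P_k$ if it is their union and their interiors are pairwise disjoint. Faces are the 2-dimensional faces. ''After a suitable rotation'' means that there is a rotation of $\mathbb{R}^3$ such that the image of the polytope has the stated property with respect to the fixed coordinate axes. The cuboctahedron is, up to similarity, the convex hull of all permutations of $(\pm1,\pm1,0)$ (8 triangular and 6 square faces). *)

(* Defs.v *)
From mathcomp Require Import all_boot all_order all_algebra perm.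
From mathcomp Require Import boolp classical_sets functions cardinality.
From mathcomp Require Import set_interval reals topology normedtype convex.

Set Implicit Arguments.
Unset Strict Implicit.
Unset Printing Implicit Defensive.

Import Order.TTheory GRing.Theory Num.Theory.
Import numFieldNormedType.Exports.

Local Open Scope classical_set_scope.
Local Open Scope card_scope.
Local Open Scope ring_scope.

Section Geometry.
Variable R : realType.
Local Notation E := 'rV[R]_3.

Implicit Types (A P S F : set E) (M : 'M[R]_3) (p : nat -> E).

Definition dot (u x : E) : R := \sum_i u 0 i * x 0 i.

Definition conv_hull A : set E := smallest (@convex_set R E) A.

Definition boundary A : set E := closure A `\` A°.

Definition segment (a b : E) : set E :=
  [set a + t *: (b - a) | t in `[0, 1]].

(* An orthogonal path has vertices [p 0], ..., [p n]; its edges are required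
   to be nondegenerate. *)

Definition axis_parallel (a b : E) : Prop :=
  exists (i : 'I_3) (c : R), c != 0 /\ b - a = c *: delta_mx 0 i.

Definition orthogonal_path (n : nat) p : Prop :=
  forall k, (k < n)%N -> axis_parallel (p k) (p k.+1).

Definition path_support (n : nat) p : set E :=
  \bigcup_(k in `I_n) segment (p k) (p k.+1).

Definition orthogonally_connected S : Prop :=
  forall x y, S x -> S y -> x <> y ->
  exists (n : nat) (p : nat -> E),
    [/\ orthogonal_path n p, p 0%N = x, p n = y & path_support n p `<=` S].

Definition convex_polytope P : Prop :=
  exists V : set E, finite_set V /\ P = conv_hull V.

(* Faces of a polytope are its intersections with supporting planes. *)
Definition is_face P F : Prop :=
  exists (u : E) (c : R),
    [/\ u != 0, (forall x, P x -> dot u x <= c)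
      & F = P `&` [set x | dot u x = c]].

Definition affinely_independent (n : nat) (p : 'I_n.+1 -> E) : bool :=
  row_free (\matrix_(i < n) (p (lift ord0 i) - p ord0)).

Definition affine_dim_ge A (n : nat) : Prop :=
  exists p : 'I_n.+1 -> E, (forall i, A (p i)) /\ affinely_independent p.

Definition affine_dim A (n : nat) : Prop :=
  affine_dim_ge A n /\ ~ affine_dim_ge A n.+1.

Definition faces2 P : set (set E) :=
  [set F | is_face P F /\ affine_dim F 2].

Definition decahedron P : Prop :=
  [/\ convex_polytope P, affine_dim P 3 & faces2 P #= `I_10].

Definition decomposed (k : nat) P (Q : 'I_k -> set E) : Prop :=
  [/\ forall i, convex_polytope (Q i),
      P = \bigcup_i Q i
    & trivIset setT (fun i => (Q i)°)].

Definition orthogonal_mx M : Prop := M *m M^T = 1%:M.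

Definition rotation M : Prop := orthogonal_mx M /\ \det M = 1.

Definition cuboctahedron_vertices : set E :=
  [set x | exists (s : 'S_3) (a b : bool),
     x = col_perm s (\row_j [:: (-1) ^+ a; (-1) ^+ b; 0]`_j)].

Definition std_cuboctahedron : set E := conv_hull cuboctahedron_vertices.

Definition is_cuboctahedron C : Prop :=
  exists (k : R) M (t : E),
    [/\ 0 < k, orthogonal_mx M
      & C = [set k *: (x *m M) + t | x in std_cuboctahedron]].

End Geometry.

(* Main.v *)
Require Import Defs.
From mathcomp Require Import all_boot all_order all_algebra perm.
From mathcomp Require Import boolp classical_sets functions cardinality.
From mathcomp Require Import interval_inference reals topology.
From mathcomp Require Import normedtype convex ring lra zify.

(** Cut the cuboctahedron by the plane through the centre that is parallel to
    a square face. This plane meets it in a square of four vertices and halves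
    the four square faces adjacent to that face along a diagonal. Each piece
    thus has ten faces: the section, the parallel square, four half squares and
    four triangles.

    Rotate the standard cuboctahedron by 45 degrees about the normal of the
    plane, and put x, p, q for the resulting coordinates, p and q being
    rescaled by the square root of two. One piece becomes [half_polytope], cut
    out by 0 <= x <= 1, x + |p| <= 2, x + |q| <= 2 and |p| + |q| <= 2; the other
    is its mirror image in x = 0. After this rotation every face is parallel to
    a coordinate axis, and any boundary point reaches the centre of the section
    x = 0 by axis-parallel moves inside faces ([half_boundary_connected]):
    - in the section, move along one axis and then along the other;
    - on a half square |p| + |q| = 2, which contains the direction of x, move
      straight down to the section;
    - on a triangle x + |p| = 2 (or x + |q| = 2), move along the axis that it
      contains to the edge shared with a half square;
    - on the face x = 1, move along an axis to an edge of a triangle.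

    The combinatorial part is proved for any polytope given by inequalities: if
    it has an interior point, and for each inequality there is a point of the
    polytope at which only this inequality is tight, then its faces are as many
    as the inequalities ([faces2_halfspaces]). The boundary is then the union
    of the facets, and invertible affine maps transport the whole description,
    so that one polytope with integral data accounts for both pieces of every
    cuboctahedron: a cuboctahedron is a homothetic image of the standard one
    rotated by 45 degrees, up to a rotation; a placement that reverses
    orientation only makes the homothety ratio negative. That the inequalities
    describe the convex hull of the expected vertices is [half_conv_hull], and
    that the two pieces fill the cuboctahedron is
    [std_cuboctahedron_halves]. *)

Set Implicit Arguments.
Unset Strict Implicit.
Unset Printing Implicit Defensive.

Import Order.TTheory GRing.Theory Num.Theory.
Import numFieldNormedType.Exports.

Local Open Scope classical_set_scope.
Local Open Scope card_scope.
Local Open Scope ring_scope.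

(** * Scalar product *)

Section DotProduct.
Variable R : realType.
Implicit Types (u v x y : 'rV[R]_3) (c : R).

Lemma dotDr u x y : dot u (x + y) = dot u x + dot u y.
Proof. by rewrite -big_split; apply: eq_bigr => i _; rewrite mxE mulrDr. Qed.

Lemma dotZr u c x : dot u (c *: x) = c * dot u x.
Proof. by rewrite mulr_sumr; apply: eq_bigr => i _; rewrite mxE mulrCA. Qed.

Lemma dotBr u x y : dot u (x - y) = dot u x - dot u y.
Proof. by rewrite dotDr -scaleN1r dotZr mulN1r. Qed.

Lemma dotZl c u x : dot (c *: u) x = c * dot u x.
Proof. by rewrite mulr_sumr; apply: eq_bigr => i _; rewrite mxE mulrA. Qed.

Lemma dot_gt0 u : u != 0 -> 0 < dot u u.
Proof.
move=> u0; have [i ui]: exists i, u 0 i != 0.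
  apply/existsP; apply: contraNT u0 => /existsPn u0.
  by apply/eqP/rowP => i; rewrite mxE; apply/eqP/negbNE/u0.
rewrite /dot (bigD1 i)//= ltr_pwDl//; first by rewrite -expr2 exprn_even_gt0.
by apply: sumr_ge0 => j _; rewrite -expr2 sqr_ge0.
Qed.

Lemma dot_mxE u x : x *m u^T = (dot u x)%:M.
Proof.
by apply/matrixP => i j; rewrite !mxE !ord1 mulr1n; apply: eq_bigr => k _;
  rewrite mxE mulrC.
Qed.

Lemma dot_continuous u : continuous (dot u).
Proof.
apply: continuous_big => [|i _ x]; first exact: add_continuous.
apply: continuousM; [exact: cst_continuous | exact: coord_continuous].
Qed.

End DotProduct.

(** * Convex hulls and affine maps *)

Section Hulls.
Variable R : realType.
Implicit Types (A K : set 'rV[R]_3) (x y t : 'rV[R]_3).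

Lemma convex_setP A : convex_set A <->
  forall x y (l : R), 0 <= l <= 1 -> A x -> A y -> A (l *: x + (1 - l) *: y).
Proof.
split=> [cA x y l /andP[l0 l1] Ax Ay|cA x y l]; last first.
  by rewrite !in_setE => Ax Ay; apply: (cA) => //; rewrite ge0 le1.
by have := cA x y (Itv01 l0 l1); rewrite !in_setE; apply.
Qed.

Lemma conv_hull_convex A : convex_set (conv_hull A).
Proof.
apply/convex_setP => x y l l01 hx hy K [cK AK].
by move/convex_setP: (cK); apply => //; [exact: hx|exact: hy].
Qed.

(** Both inclusions use only that preimages and images of convex sets under an
    affine map are convex. *)
Lemma conv_hull_affine A (N : 'M[R]_3) t :
  conv_hull [set x *m N + t | x in A] = [set x *m N + t | x in conv_hull A].
Proof.
have affE x y (l : R) : (l *: x + (1 - l) *: y) *m N + t =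
    l *: (x *m N + t) + (1 - l) *: (y *m N + t).
  by rewrite mulmxDl -!scalemxAl !scalerDr addrACA -scalerDl [l + _]addrC
    subrK scale1r.
apply/seteqP; split.
  apply: smallest_sub; last by apply: image_subset; apply: sub_gen_smallest.
  apply/convex_setP => _ _ l l01 [x hx <-] [y hy <-]; rewrite -affE.
  by exists (l *: x + (1 - l) *: y) => //; move/convex_setP:
    (@conv_hull_convex A); apply.
apply/image_subP; apply: (@smallest_sub _ _ _
  [set x | conv_hull [set y *m N + t | y in A] (x *m N + t)]) => [|x Ax].
  apply/convex_setP => x y l l01 /= hx hy; rewrite affE.
  by move/convex_setP: (@conv_hull_convex [set x *m N + t | x in A]); apply.
by apply: sub_gen_smallest; exists x.
Qed.

Lemma conv_hull_linear A (N : 'M[R]_3) :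
  conv_hull [set x *m N | x in A] = [set x *m N | x in conv_hull A].
Proof.
have := conv_hull_affine A N 0.
by rewrite (_ : (fun x => x *m N + 0) = mulmx^~ N)//; apply/funext => x;
  rewrite addr0.
Qed.

Lemma convex_polytope_affine A (N : 'M[R]_3) t :
  convex_polytope A -> convex_polytope [set x *m N + t | x in A].
Proof.
move=> [V [finV ->]]; exists [set x *m N + t | x in V].
by split; [exact: finite_image | rewrite conv_hull_affine].
Qed.

End Hulls.

(** * Affine dimension *)

Section AffineDimension.
Variable R : realType.
Implicit Types (A : set 'rV[R]_3) (u v w : 'rV[R]_3).

Lemma near_right_line A w v : A° w ->
  \forall e \near (0 : R)^'+, A (w + e *: v).
Proof.
move=> Aw; apply: cvg_within; rewrite /=.
have : {for 0, continuous (fun e : R => w + e *: v)}.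
  apply: continuousD; first exact: cst_continuous.
  by apply: continuousZl; exact: cvg_id.
by move/(_ A); rewrite scale0r addr0; apply.
Qed.

(** Lower bounds on dimensions come from one point and independent directions
    in which a small move stays in the set. *)
Lemma affine_dim_ge_directions A w m (B : 'M[R]_(m, 3)) : row_free B -> A w ->
  (forall i, \forall e \near (0 : R)^'+, A (w + e *: row i B)) ->
  affine_dim_ge A m.
Proof.
move=> freeB Aw near_w.
(* one step length that works in all the directions *)
have [e [e0 Ae]] : exists e : R, 0 < e /\ forall i, A (w + e *: row i B).
  near (0 : R)^'+ => e; exists e; split; first by near: e; exact: nbhs_right_gt.
  near: e; exact: filter_forall.
pose p (i : 'I_m.+1) := oapp (fun j => w + e *: row j B) w (unlift ord0 i).
have p0 : p ord0 = w by rewrite /p unlift_none.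
have pS i : p (lift ord0 i) = w + e *: row i B by rewrite /p liftK.
exists p; split; first by move=> i; rewrite /p; case: unlift.
rewrite /affinely_independent (_ : \matrix_(i < m) _ = e *: B).
  by rewrite /row_free mxrank_scale_nz// gt_eqF.
by apply/row_matrixP => i; rewrite rowK p0 pS addrC addKr linearZ.
Unshelve. all: by end_near. Qed.

Lemma affine_dim_ge_le3 A m : affine_dim_ge A m -> (m <= 3)%N.
Proof.
by move=> [p [_ /eqP <-]]; apply: rank_leq_col.
Qed.

Lemma rank_normal u : u != 0 -> \rank (kermx u^T) = 2%N.
Proof. by move=> u0; rewrite mxrank_ker mxrank_tr rank_rV u0. Qed.

(** The differences of the points lie in the orthogonal of the normal, a space
    of rank two. *)
Lemma affine_dim_ge_plane A u c m : u != 0 -> (forall x, A x -> dot u x = c) ->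
  affine_dim_ge A m -> (m <= 2)%N.
Proof.
move=> u0 Au [p [Ap /eqP <-]].
apply: leq_trans (eq_leq (rank_normal u0)); apply: mxrankS.
apply/row_subP => i; rewrite rowK; apply/sub_kermxP.
by rewrite dot_mxE dotBr !(Au _ (Ap _)) subrr raddf0.
Qed.

(** Two independent directions in a plane of space leave only one line for its
    normals. *)
Lemma normal_unique (p : 'I_3 -> 'rV[R]_3) u v c d : affinely_independent p ->
  v != 0 -> (forall i, dot u (p i) = c) -> (forall i, dot v (p i) = d) ->
  exists l : R, u = l *: v /\ c = l * d.
Proof.
set B := \matrix_(i < 2) (p (lift ord0 i) - p ord0).
move=> /eqP rkB v0 uc vd.
have orth w e : (forall i, dot w (p i) = e) -> w *m B^T = 0.
  move=> we; apply: trmx_inj; rewrite trmx_mul trmxK trmx0.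
  apply/row_matrixP => i; rewrite row_mul rowK row0.
  by rewrite dot_mxE dotBr !we subrr raddf0.
have rk1 : \rank (kermx B^T) = 1%N by rewrite mxrank_ker mxrank_tr rkB.
have uB : (u <= kermx B^T)%MS by apply/sub_kermxP/(orth _ c).
have vB : (v <= kermx B^T)%MS by apply/sub_kermxP/(orth _ d).
have : (u <= v)%MS.
  apply: submx_trans uB _; have [_ eqv] := mxrank_leqif_sup vB.
  by rewrite -eqv rk1 rank_rV v0.
move=> /sub_rVP[l ul]; exists l; split=> //.
by rewrite -(uc ord0) ul dotZl vd.
Qed.

End AffineDimension.

(** * Polytopes given by inequalities *)

Section Hpolytopes.
Variables (R : realType) (n : nat).
Variables (N : 'I_n -> 'rV[R]_3) (b : 'I_n -> R).
Implicit Types (F : set 'rV[R]_3) (u v w x y : 'rV[R]_3).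

Definition halfspaces : set 'rV[R]_3 :=
  [set x | forall i, dot (N i) x <= b i].

Definition facet (j : 'I_n) : set 'rV[R]_3 :=
  halfspaces `&` [set x | dot (N j) x = b j].

Lemma near_strict (P : pred 'I_n) x : (forall i, P i -> dot (N i) x < b i) ->
  \forall y \near x, forall i, P i -> dot (N i) y < b i.
Proof.
move=> xP; apply: (@filter_forall _ _
  (fun i y => P i -> dot (N i) y < b i) (nbhs x)) => i.
have [Pi|_] := boolP (P i); last first.
  by apply: nearW.
have xi : nbhs x [set y | dot (N i) y < b i].
  have ob : open_nbhs (dot (N i) x) [set r | r < b i].
    by split; [exact: open_lt | exact: xP].
  exact: (@dot_continuous R (N i) x _ (open_nbhs_nbhs ob)).
by apply: filterS xi => y yi _.
Qed.

Lemma closed_halfspaces : closed halfspaces.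
Proof.
rewrite (_ : halfspaces = \bigcap_(i in setT) [set x | dot (N i) x <= b i]).
  apply: closed_bigI => i _.
  apply: (preimage_closed _ (@closed_le _ (b i))) => x _.
  exact: dot_continuous.
by apply/seteqP; split=> [x hx i _|x hx i]; exact: hx.
Qed.

Lemma convex_halfspaces : convex_set halfspaces.
Proof.
apply/convex_setP => x y l /andP[l0 l1] hx hy i.
rewrite dotDr !dotZr (_ : b i = l * b i + (1 - l) * b i); last by ring.
by apply: lerD; apply: ler_wpM2l; rewrite ?subr_ge0.
Qed.

Lemma convex_facet j : convex_set (facet j).
Proof.
apply/convex_setP => x y l l01 [hx xj] [hy yj]; split.
  by move/convex_setP: convex_halfspaces; apply.
by rewrite /= dotDr !dotZr xj yj; ring.
Qed.

Section NonzeroNormals.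
Hypothesis N0 : forall i, N i != 0.

(** From a point where an inequality is tight, any outward move along its normal
    leaves the polytope. *)
Lemma interior_halfspaces :
  halfspaces° = [set x | forall i, dot (N i) x < b i].
Proof.
apply/seteqP; split=> x xP.
  move=> i; have xi := interior_subset xP i.
  rewrite lt_neqAle xi andbT; apply/negP => /eqP tight.
  (* a small outward step would stay inside *)
  have [e [e0 /(_ i)]] : exists e : R, 0 < e /\ halfspaces (x + e *: N i).
    near (0 : R)^'+ => e; exists e; split.
      by near: e; exact: nbhs_right_gt.
    by near: e; exact: near_right_line.
  by rewrite dotDr dotZr tight gerDl leNgt mulr_gt0// dot_gt0.
have := @near_strict predT x (fun i _ => xP i).
by apply: filterS => y yP i; exact/ltW/yP.
Unshelve. all: by end_near. Qed.

Lemma boundary_halfspaces : boundary halfspaces = \bigcup_j facet j.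
Proof.
rewrite /boundary -(closure_id _).1; last exact: closed_halfspaces.
rewrite interior_halfspaces; apply/seteqP; split=> [x [xP xI]|x [j _ [xP xj]]].
  apply: contrapT => xF; apply: xI => i; rewrite lt_neqAle xP andbT.
  by apply/eqP => xi; apply: xF; exists i.
by split=> // /(_ j); rewrite xj ltxx.
Qed.

(** The centroid of three affinely independent points of the face makes some
    inequality tight, and then so do the three points, hence the supporting
    plane of the face is the plane of that inequality. *)
Lemma face2_facet F : halfspaces° !=set0 ->
  is_face halfspaces F -> affine_dim_ge F 2 -> exists j, F = facet j.
Proof.
move=> [c cI] [u [h [u0 uh ->]]] [p [pF indep]].
have pP i : halfspaces (p i) := (pF i).1.
have pu i : dot u (p i) = h := (pF i).2.
pose m := 3^-1 *: (p 0 + p 1 + p 2%:R).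
have dotm v : dot v m = 3^-1 * (dot v (p 0) + dot v (p 1) + dot v (p 2%:R)).
  by rewrite /m dotZr !dotDr.
have [j mj] : exists j, dot (N j) m = b j.
  apply: contrapT => nj; have mI : halfspaces° m.
    rewrite interior_halfspaces => j; rewrite lt_neqAle; apply/andP; split.
      by apply/eqP => mj; apply: nj; exists j.
    by rewrite dotm; have := (pP 0 j, pP 1 j, pP 2%:R j) => -[[]]; lra.
  (* stepping from [m] along [u] would exceed the maximum [h] of [dot u] *)
  have [e [e0]] : exists e : R, 0 < e /\ halfspaces (m + e *: u).
    near (0 : R)^'+ => e; exists e; split.
      by near: e; exact: nbhs_right_gt.
    by near: e; exact: near_right_line.
  move=> /uh; rewrite dotDr dotZr dotm !pu.
  have := mulr_gt0 e0 (dot_gt0 u0); lra.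
have pj i : dot (N j) (p i) = b j.
  have : [/\ dot (N j) (p 0) = b j, dot (N j) (p 1) = b j
           & dot (N j) (p 2%:R) = b j].
    have := (pP 0 j, pP 1 j, pP 2%:R j) => -[[]] *.
    by rewrite dotm in mj; split; lra.
  case=> p0 p1 p2; have : i \in [:: 0; 1; 2%:R] by case: i => -[|[|[|]]].
  by rewrite !inE => /or3P[]/eqP ->.
have [l [ul hl]] := normal_unique indep (N0 j) pu pj.
have l0 : l != 0 by apply: contraNneq u0 => l0; rewrite ul l0 scale0r.
exists j; apply/seteqP; split=> x [xP xu]; split=> //=; move: xu => /=;
  rewrite ul hl dotZl; last by move=> ->.
exact: mulfI.
Unshelve. all: by end_near. Qed.

(** The point [w] stays on the facet when moved a little in two independent
    directions orthogonal to the normal. *)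
Lemma affine_dim_facet j w : facet j w ->
  (forall i, i != j -> dot (N i) w < b i) -> affine_dim (facet j) 2.
Proof.
move=> Fw strict; split; last first.
  move=> /(@affine_dim_ge_plane _ _ (N j) (b j) 3 (N0 j)) H.
  by have := H (fun x => @proj2 _ _).
have [B [freeB NB]] : exists B : 'M[R]_(2, 3), row_free B /\ B *m (N j)^T = 0.
  have := mulmx_ker (N j)^T; have := row_base_free (kermx (N j)^T).
  have := eq_row_base (kermx (N j)^T).
  move: (row_base _); rewrite (rank_normal (N0 j)) => B eqB freeB kerN.
  by exists B; split=> //; apply/sub_kermxP; rewrite eqB.
apply: (affine_dim_ge_directions freeB Fw) => k.
have near_w : \forall y \near w, forall i, i != j -> dot (N i) y < b i.
  exact: (@near_strict (predC1 j)).
have NBk : dot (N j) (row k B) = 0.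
  have := congr1 (fun C : 'cV_2 => C k 0) NB; rewrite !mxE => <-.
  by apply: eq_bigr => i _; rewrite !mxE mulrC.
apply: filterS (near_right_line (row k B) near_w) => e we.
have tight : dot (N j) (w + e *: row k B) = b j.
  by rewrite dotDr dotZr NBk mulr0 addr0 Fw.2.
split=> // i; have [->|ij] := eqVneq i j; first by rewrite tight.
exact/ltW/we.
Qed.

(** [face2_facet] bounds the number of faces from above. The witness [w j], at
    which only the inequality [j] is tight, shows that the facet [j] has
    dimension two and differs from the others. *)
Theorem faces2_halfspaces (w : 'I_n -> 'rV[R]_3) : halfspaces° !=set0 ->
  (forall i j, dot (N i) (w j) <= b i ?= iff (i == j)) ->
  affine_dim halfspaces 3 /\ faces2 halfspaces #= `I_n.
Proof.
move=> P0 ww; have [c cI] := P0; split.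
  split; last by move=> /affine_dim_ge_le3.
  apply: (@affine_dim_ge_directions _ _ c _ 1%:M).
  - by rewrite row_free_unit unitmx1.
  - exact: interior_subset cI.
  - by move=> i; exact: near_right_line.
have wP j : halfspaces (w j) by move=> i; exact: ww.
have wF j : facet j (w j) by split=> //=; apply/eqP; rewrite ww.
rewrite (_ : faces2 _ = [set facet j | j in [set: 'I_n]]); last first.
  apply/seteqP; split=> [F [face [dim2 _]]|_ [j _ <-]].
    by have [j ->] := face2_facet P0 face dim2; exists j.
  split; first by exists (N j), (b j); split=> // x; apply.
  apply: affine_dim_facet (wF j) _ => i ij.
  by rewrite (lt_leif (ww i j)).
apply: card_eq_trans (inj_card_eq _) (card_esym card_II) => i j _ _ Fij.
by have [_ /eqP] : facet j (w i) by [rewrite -Fij]; rewrite ww => /eqP.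
Qed.

End NonzeroNormals.

End Hpolytopes.

(** * Affine images of polytopes given by inequalities *)

Section AffineImages.
Variables (R : realType) (n : nat) (N : 'I_n -> 'rV[R]_3) (b : 'I_n -> R).
Variables (A : 'M[R]_3) (t : 'rV[R]_3).
Hypothesis unitA : A \in unitmx.

(** Normals are transformed by the inverse transpose. *)
Definition image_normal (i : 'I_n) := N i *m (invmx A)^T.
Definition image_bound (i : 'I_n) := b i + dot (image_normal i) t.

Lemma dot_image_normal i x :
  dot (image_normal i) (x *m A + t) = dot (N i) x + dot (image_normal i) t.
Proof.
rewrite dotDr; congr (_ + _).
suff /matrixP/(_ 0 0) : (dot (image_normal i) (x *m A))%:M =
    (dot (N i) x)%:M :> 'M_1 by rewrite !mxE.
by rewrite -!dot_mxE /image_normal trmx_mul trmxK mulmxA mulmxK.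
Qed.

Lemma dot_image_normal_inv i y :
  dot (image_normal i) y =
  dot (N i) ((y - t) *m invmx A) + dot (image_normal i) t.
Proof. by rewrite -dot_image_normal mulmxKV// subrK. Qed.

Lemma image_normal_neq0 i : N i != 0 -> image_normal i != 0.
Proof.
apply: contra_neq => /(congr1 (mulmx^~ A^T)); rewrite mul0mx -mulmxA -trmx_mul.
by rewrite mulmxV// trmx1 mulmx1.
Qed.

Lemma affine_image_preimage (S : set 'rV[R]_3) :
  [set x *m A + t | x in S] = [set y | S ((y - t) *m invmx A)].
Proof.
apply/seteqP; split=> [_ [x Sx <-]|y Sy] /=; first by rewrite addrK mulmxK.
by exists ((y - t) *m invmx A); rewrite // mulmxKV// subrK.
Qed.

Lemma halfspaces_affine :
  [set x *m A + t | x in halfspaces N b] = halfspaces image_normal image_bound.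
Proof.
rewrite affine_image_preimage; apply/seteqP; split=> y hy i; have := hy i;
  by rewrite dot_image_normal_inv lerD2r.
Qed.

Lemma facet_affine i : [set x *m A + t | x in facet N b i] =
  facet image_normal image_bound i.
Proof.
rewrite /facet -halfspaces_affine !affine_image_preimage.
have E y : (dot (image_normal i) y = image_bound i) =
    (dot (N i) ((y - t) *m invmx A) = b i).
  rewrite dot_image_normal_inv; apply/propext.
  by split=> [/addIr|->].
by apply/seteqP; split=> y /= []; rewrite E.
Qed.

Hypothesis N0 : forall i, N i != 0.

Lemma interior_halfspaces_affine :
  [set x *m A + t | x in halfspaces N b]° =
  [set x *m A + t | x in [set x | forall i, dot (N i) x < b i]].
Proof.
rewrite halfspaces_affine interior_halfspaces; last first.
  by move=> i; exact: image_normal_neq0.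
rewrite affine_image_preimage; apply/seteqP; split=> y hy i; have := hy i;
  by rewrite dot_image_normal_inv ltrD2r.
Qed.

Lemma boundary_halfspaces_affine :
  boundary [set x *m A + t | x in halfspaces N b] =
  [set x *m A + t | x in \bigcup_i facet N b i].
Proof.
rewrite halfspaces_affine boundary_halfspaces; last first.
  by move=> i; exact: image_normal_neq0.
by rewrite image_bigcup; apply: eq_bigcupr => i _; rewrite facet_affine.
Qed.

Lemma faces2_halfspaces_affine (c : 'rV[R]_3) (w : 'I_n -> 'rV[R]_3) :
  (forall i, dot (N i) c < b i) ->
  (forall i j, dot (N i) (w j) <= b i ?= iff (i == j)) ->
  affine_dim [set x *m A + t | x in halfspaces N b] 3 /\
  faces2 [set x *m A + t | x in halfspaces N b] #= `I_n.
Proof.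
move=> cI ww; have P0 : [set x *m A + t | x in halfspaces N b]° !=set0.
  by rewrite interior_halfspaces_affine; exists (c *m A + t), c.
rewrite halfspaces_affine in P0 *.
apply: (faces2_halfspaces _ (w := fun j => w j *m A + t)) => //.
  by move=> i; exact: image_normal_neq0.
move=> i j; rewrite dot_image_normal; have [le_w eq_w] := ww i j.
by split; rewrite ?lerD2r// (inj_eq (addIr _)).
Qed.

End AffineImages.

(** * Orthogonal paths *)

Section OrthogonalPaths.
Variable R : realType.
Implicit Types (S F : set 'rV[R]_3) (x y z t : 'rV[R]_3).

(** Contrary to orthogonal connectedness, this relates every point to itself,
    by the path without edges, which makes it an equivalence relation. *)
Definition linked S x y := exists (n : nat) (p : nat -> 'rV[R]_3),
  [/\ orthogonal_path n p, p 0%N = x, p n = y & path_support n p `<=` S].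

Lemma linked_refl S x : linked S x x.
Proof.
by exists 0%N, (fun=> x); split=> // y [].
Qed.

Lemma linked_trans S x y z : linked S x y -> linked S y z -> linked S x z.
Proof.
move=> [n [p [op p0 pn pS]]] [m [q [oq q0 qm qS]]].
pose r k := if (k <= n)%N then p k else q (k - n)%N.
have rp k : (k <= n)%N -> r k = p k by rewrite /r => ->.
have rq k : (n <= k)%N -> r k = q (k - n)%N.
  rewrite /r leq_eqVlt => /predU1P[<-|]; first by rewrite leqnn subnn pn q0.
  by rewrite ltnNge => /negbTE ->.
exists (n + m)%N, r; split.
- move=> k knm; have [kn|nk] := ltnP k n.
    by rewrite !rp// ?(ltnW kn)//; exact: op.
  by rewrite !rq// ?(leqW nk)// subSn//; apply: oq; rewrite ltn_subLR.
- by rewrite rp.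
- by rewrite rq ?leq_addr// addKn.
- move=> v [k /= knm]; have [kn|nk] := ltnP k n.
    by rewrite !rp// ?(ltnW kn)// => pv; apply: pS; exists k.
  rewrite !rq// ?(leqW nk)// subSn// => qv; apply: qS; exists (k - n)%N => //=.
  by rewrite ltn_subLR.
Qed.

Lemma segment_sym x y : segment x y = segment y x.
Proof.
suff sub : forall u v : 'rV[R]_3, segment u v `<=` segment v u by
  apply/seteqP; split; exact: sub.
move=> {}x {}y _ [l + <-]; rewrite /= in_itv/= => /andP[l0 l1]; exists (1 - l).
  by rewrite /= in_itv/=; lra.
by apply/rowP => i; rewrite !mxE; ring.
Qed.

Lemma axis_parallel_sym x y : axis_parallel x y -> axis_parallel y x.
Proof.
by move=> [i [c [c0 xy]]]; exists i, (- c); rewrite oppr_eq0 scaleNr -xy opprB.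
Qed.

Lemma linked_sym S x y : linked S x y -> linked S y x.
Proof.
move=> [n [p [op p0 pn pS]]]; exists n, (fun k => p (n - k)%N).
have rev k : (k < n)%N ->
    exists2 l, (l < n)%N & (n - k)%N = l.+1 /\ (n - k.+1)%N = l.
  by move=> kn; exists (n - k.+1)%N; [lia | split=> //; lia].
split; rewrite ?subn0 ?subnn//.
  by move=> k /rev[l ln [-> ->]]; exact/axis_parallel_sym/op.
move=> v [k /= /rev[l ln [-> ->]]]; rewrite segment_sym => lv.
by apply: pS; exists l.
Qed.

(** Points may coincide here, so that moves of length zero require no case
    analysis. *)
Lemma linked_axis S F x y (i : 'I_3) : convex_set F -> F `<=` S ->
  F x -> F y -> (forall k, k != i -> x 0 k = y 0 k) -> linked S x y.
Proof.
move=> cF FS Fx Fy xy; have [->|neq_xy] := eqVneq x y; first exact: linked_refl.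
have yx : y - x = (y 0 i - x 0 i) *: delta_mx 0 i.
  apply/rowP => k; rewrite !mxE/= ; have [->|/xy ->] := eqVneq k i.
    by rewrite mulr1.
  by rewrite mulr0 subrr.
exists 1%N, (fun k => if k is 0%N then x else y); split=> //.
  move=> [|//] _; exists i, (y 0 i - x 0 i); split=> //.
  by apply: contra_neq neq_xy => c0; apply/esym/subr0_eq; rewrite yx c0 scale0r.
move=> _ [[|//] _ [l + <-]]; rewrite /= in_itv => l01.
apply: FS; move/convex_setP: cF => /(_ y x l l01 Fy Fx); congr F.
by apply/rowP => k; rewrite !mxE; ring.
Qed.

Lemma orthogonally_connected_root S z : (forall x, S x -> linked S x z) ->
  orthogonally_connected S.
Proof.
by move=> Sz x y /Sz xz /Sz/linked_sym zy _; exact: linked_trans xz zy.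
Qed.

(** Diagonal maps are the linear maps that keep the direction of each axis. *)
Lemma orthogonally_connected_diag S (a : 'rV[R]_3) t :
  (forall i, a 0 i != 0) -> orthogonally_connected S ->
  orthogonally_connected [set x *m diag_mx a + t | x in S].
Proof.
move=> a0 cS _ _ [x Sx <-] [y Sy <-] neq_xy.
have [|n [p [op p0 pn pS]]] := cS x y Sx Sy.
  by move=> xy; apply: neq_xy; rewrite xy.
exists n, (fun k => p k *m diag_mx a + t); split; rewrite ?p0 ?pn//.
  move=> k /op[i [c [c0 pk]]]; exists i, (c * a 0 i); split.
    by rewrite mulf_neq0.
  by rewrite opprD addrACA subrr addr0 -mulmxBl pk -scalemxAl -rowE
    row_diag_mx scalerA.
move=> _ [k /= kn [l l01 <-]]; exists (p k + l *: (p k.+1 - p k)).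
  by apply: pS; exists k => //; exists l.
by rewrite mulmxDl -scalemxAl mulmxBl opprD addrACA subrr addr0 addrAC.
Qed.

End OrthogonalPaths.

(** * Half of a cuboctahedron *)

Section HalfCuboctahedron.
Variable R : realType.
Implicit Types (K : set 'rV[R]_3) (x p q : R).

Definition vec3 x p q : 'rV[R]_3 := \row_j [:: x; p; q]`_j.

Lemma vec3_eta (v : 'rV[R]_3) : v = vec3 (v 0 0) (v 0 1) (v 0 2%:R).
Proof.
by apply/rowP => -[[|[|[|//]]] lt_i]; rewrite mxE/=; congr (v 0 _);
  exact: val_inj.
Qed.

Lemma vec3D x p q x' p' q' :
  vec3 x p q + vec3 x' p' q' = vec3 (x + x') (p + p') (q + q').
Proof. by apply/rowP => -[[|[|[|//]]] lt_i]; rewrite !mxE. Qed.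

Lemma vec3Z k x p q : k *: vec3 x p q = vec3 (k * x) (k * p) (k * q).
Proof. by apply/rowP => -[[|[|[|//]]] lt_i]; rewrite !mxE. Qed.

Lemma vec3_diag x p q a b c :
  vec3 x p q *m diag_mx (vec3 a b c) = vec3 (x * a) (p * b) (q * c).
Proof.
by rewrite mul_mx_diag; apply/rowP => -[[|[|[|//]]] lt_i]; rewrite !mxE.
Qed.

Lemma dot_vec3 a b c x p q :
  dot (vec3 a b c) (vec3 x p q) = a * x + b * p + c * q.
Proof. by rewrite /dot !big_ord_recr big_ord0/= !mxE/= add0r. Qed.

(** The section, the opposite square, the four triangles, the four half
    squares. *)
Definition half_normals : seq 'rV[R]_3 :=
  [:: vec3 (-1) 0 0; vec3 1 0 0;
      vec3 1 1 0; vec3 1 (-1) 0; vec3 1 0 1; vec3 1 0 (-1);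
      vec3 0 1 1; vec3 0 1 (-1); vec3 0 (-1) 1; vec3 0 (-1) (-1)].

Definition half_bounds : seq R := [:: 0; 1; 2; 2; 2; 2; 2; 2; 2; 2].

Definition half_normal (i : 'I_10) := half_normals`_i.
Definition half_bound (i : 'I_10) := half_bounds`_i.

Definition half_polytope := halfspaces half_normal half_bound.

Definition half_ineqs x p q : bool :=
  [&& 0 <= x, x <= 1, x + p <= 2, x - p <= 2, x + q <= 2, x - q <= 2,
      p + q <= 2, p - q <= 2, - p + q <= 2 & - p - q <= 2].

Lemma halfE x p q : half_polytope (vec3 x p q) <-> half_ineqs x p q.
Proof.
split=> [h|h]; last first.
  move=> [[|[|[|[|[|[|[|[|[|[|//]]]]]]]]]] lt_i];
    rewrite /half_normal /half_bound/= dot_vec3; move: h;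
    rewrite /half_ineqs; lra.
have hk k (k10 : (k < 10)%N) := h (Ordinal k10).
have := (hk 0 isT, hk 1 isT, hk 2 isT, hk 3 isT, hk 4 isT, hk 5 isT, hk 6 isT,
  hk 7 isT, hk 8 isT, hk 9 isT)%N.
rewrite /half_normal /half_bound/= !dot_vec3 /half_ineqs.
case=> -[[[[[[[[]]]]]]]] *; lra.
Qed.

Definition half_vertices : seq 'rV[R]_3 :=
  [:: vec3 0 2 0; vec3 0 (-2) 0; vec3 0 0 2; vec3 0 0 (-2);
      vec3 1 1 1; vec3 1 1 (-1); vec3 1 (-1) 1; vec3 1 (-1) (-1)].

Lemma convex_comb3 K (u v w : 'rV[R]_3) (a b c : R) : convex_set K ->
  K u -> K v -> K w -> 0 <= a -> 0 <= b -> 0 <= c -> a + b + c = 1 ->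
  K (a *: u + b *: v + c *: w).
Proof.
move=> /convex_setP cK Ku Kv Kw a0 b0 c0 abc.
have [c1|c1] := eqVneq c 1.
  have [-> ->] : a = 0 /\ b = 0 by lra.
  by rewrite c1 !scale0r scale1r !add0r.
have c1' : 1 - c != 0 by rewrite subr_eq0 eq_sym.
have cle : 0 < 1 - c by rewrite lt_def c1'; lra.
have -> : a *: u + b *: v + c *: w =
    c *: w + (1 - c) *: ((a / (1 - c)) *: u + (1 - a / (1 - c)) *: v).
  have -> : 1 - a / (1 - c) = b / (1 - c).
    by apply: (mulIf c1'); rewrite mulrBl !mulfVK//; lra.
  by rewrite scalerDr !scalerA !(mulrC (1 - c)) !mulfVK// addrC.
apply: (cK) => //; first by lra.
apply: cK => //; rewrite divr_ge0 ?(ltW cle)//= ler_pdivrMr//; lra.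
Qed.

(** The point (x, p, q) lies between (x, p, c) and (x, p, - c), where c is the
    smaller of 2 - x and 2 - |p|. If |p| <= x, these two points lie in
    triangular faces of the cuboctahedron, otherwise in half squares; in both
    cases they have explicit barycentric coordinates. *)
Lemma half_sub_convex K : convex_set K -> [set` half_vertices] `<=` K ->
  half_polytope `<=` K.
Proof.
move=> cK vK v; rewrite (vec3_eta v); move: (v 0 0) (v 0 1) (v 0 2%:R) => x p q.
move=> /halfE h.
have vert u : u \in half_vertices -> K u by move=> /vK.
have squeeze c : -c <= q <= c -> K (vec3 x p c) -> K (vec3 x p (- c)) ->
    K (vec3 x p q).
  move=> /andP[cq qc] Kc KNc; have [c0|c0] := eqVneq c 0.
    by have -> : q = c by lra.
  have c_gt0 : 0 < c by rewrite lt_def c0; lra.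
  move/convex_setP: cK => /(_ _ _ ((c + q) / (2 * c)) _ Kc KNc).
  (* the coefficient solves l * c - (1 - l) * c = q *)
  rewrite !vec3Z vec3D.
  have -> : (c + q) / (2 * c) * x + (1 - (c + q) / (2 * c)) * x = x by ring.
  have -> : (c + q) / (2 * c) * p + (1 - (c + q) / (2 * c)) * p = p by ring.
  have -> : (c + q) / (2 * c) * c + (1 - (c + q) / (2 * c)) * - c = q by field.
  by apply; rewrite divr_ge0 ?ler_pdivrMr ?mulr_gt0//=; lra.
have tri (u1 u2 u3 : 'rV[R]_3) a b c r : u1 \in half_vertices ->
    u2 \in half_vertices -> u3 \in half_vertices ->
    0 <= a -> 0 <= b -> 0 <= c -> a + b + c = 1 ->
    vec3 x p r = a *: u1 + b *: u2 + c *: u3 -> K (vec3 x p r).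
  by move=> /vert ? /vert ? /vert ? ? ? ? ? ->; exact: convex_comb3.
have inV : [/\ vec3 0 2 0 \in half_vertices, vec3 0 (-2) 0 \in half_vertices,
    forall s : bool, vec3 0 0 ((-1) ^+ s * 2) \in half_vertices &
    forall s s' : bool, vec3 1 ((-1) ^+ s) ((-1) ^+ s') \in half_vertices].
  split=> [||s|s s']; try case: s; try case: s';
    by rewrite ?expr0 ?expr1 ?mulN1r ?mul1r !inE !eqxx ?orbT.
case: inV => V1 V2 V3 V4; move: h; rewrite /half_ineqs => h.
have sgn (f : bool -> R) : (forall s, K (vec3 x p (f s))) ->
   f true = - f false -> -f false <= q <= f false -> K (vec3 x p q).
  move=> Kf fN fq; apply: squeeze fq _ _ => //; rewrite -fN//.
have [px|px] := lerP p x; [have [xp|xp] := lerP (- x) p|].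
- apply: (sgn (fun s => (-1) ^+ s * (2 - x))) => [s||]; last 2 first.
  + by rewrite expr0 expr1; ring.
  + by rewrite expr0; lra.
  apply: (tri _ _ _ (1 - x) ((x + p) / 2) ((x - p) / 2) _ (V3 s) (V4 false s)
    (V4 true s)); [lra..|].
  by rewrite !vec3Z !vec3D expr0 expr1; congr vec3; field.
- apply: (sgn (fun s => (-1) ^+ s * (2 + p))) => [s||]; last 2 first.
  + by rewrite expr0 expr1; ring.
  + by rewrite expr0; lra.
  apply: (tri _ _ _ x ((- p - x) / 2) ((2 + p - x) / 2) _ (V4 true s) V2
    (V3 s)); [lra..|].
  by rewrite !vec3Z !vec3D expr1; congr vec3; field.
- apply: (sgn (fun s => (-1) ^+ s * (2 - p))) => [s||]; last 2 first.
  + by rewrite expr0 expr1; ring.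
  + by rewrite expr0; lra.
  apply: (tri _ _ _ x ((p - x) / 2) ((2 - p - x) / 2) _ (V4 false s) V1
    (V3 s)); [lra..|].
  by rewrite !vec3Z !vec3D expr0; congr vec3; field.
Qed.

Lemma half_conv_hull : half_polytope = conv_hull [set` half_vertices].
Proof.
apply/seteqP; split.
  apply: half_sub_convex; first exact: conv_hull_convex.
  exact: sub_gen_smallest.
apply: smallest_sub; first exact: convex_halfspaces.
by move=> v; rewrite /= !inE => /or4P[|||/or4P[|||/orP[]]] => /eqP ->;
  apply/halfE; rewrite /half_ineqs; lra.
Qed.

Definition half_witnesses : seq 'rV[R]_3 :=
  [:: vec3 0 0 0; vec3 1 0 0;
      vec3 2^-1 (3 / 2) 0; vec3 2^-1 (- 3 / 2) 0;
      vec3 2^-1 0 (3 / 2); vec3 2^-1 0 (- 3 / 2);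
      vec3 2^-1 1 1; vec3 2^-1 1 (-1); vec3 2^-1 (-1) 1; vec3 2^-1 (-1) (-1)].

Lemma half_witnessP (i j : 'I_10) :
  dot (half_normal i) half_witnesses`_j <= half_bound i ?= iff (i == j).
Proof.
apply/leifP; rewrite -val_eqE.
case: i => -[|[|[|[|[|[|[|[|[|[|//]]]]]]]]]] lt_i;
case: j => -[|[|[|[|[|[|[|[|[|[|//]]]]]]]]]] lt_j;
  rewrite /half_normal /half_bound/= dot_vec3; first [lra | apply/eqP; lra].
Qed.

Lemma half_interior i : dot (half_normal i) (vec3 2^-1 0 0) < half_bound i.
Proof.
case: i => -[|[|[|[|[|[|[|[|[|[|//]]]]]]]]]] lt_i;
  rewrite /half_normal /half_bound/= dot_vec3; lra.
Qed.

Lemma half_normal_neq0 i : half_normal i != 0.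
Proof.
apply/eqP => N0; have := half_interior i.
have /eqP <- : dot (half_normal i) half_witnesses`_i == half_bound i.
  by rewrite half_witnessP.
by rewrite N0 -(scale0r 0) !dotZl !mul0r ltxx.
Qed.

End HalfCuboctahedron.

(** * Orthogonal paths on the boundary of the half *)

Section HalfBoundary.
Variable R : realType.
Implicit Types x p q : R.

Definition half_boundary : set 'rV[R]_3 :=
  \bigcup_i facet (@half_normal R) (@half_bound R) i.

Lemma linked_in_facet k (k10 : (k < 10)%N) (i : 'I_3) (u v : 'rV[R]_3) :
  half_polytope u -> half_polytope v ->
  dot (half_normal R (Ordinal k10)) u = half_bound R (Ordinal k10) ->
  dot (half_normal R (Ordinal k10)) v = half_bound R (Ordinal k10) ->
  (forall j, j != i -> u 0 j = v 0 j) -> linked half_boundary u v.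
Proof.
move=> hu hv uk vk uv.
have cF : convex_set (facet (@half_normal R) (@half_bound R) (Ordinal k10)).
  exact: convex_facet.
apply: (linked_axis cF _ _ _ uv) => //.
exact: bigcup_sup.
Qed.

Lemma vec3_eq0 x p q x' :
  forall j : 'I_3, j != 0 -> vec3 x p q 0 j = vec3 x' p q 0 j.
Proof. by move=> [[|[|[|//]]] lt_j]; rewrite !mxE. Qed.

Lemma vec3_eq1 x p q p' :
  forall j : 'I_3, j != 1 -> vec3 x p q 0 j = vec3 x p' q 0 j.
Proof. by move=> [[|[|[|//]]] lt_j]; rewrite !mxE. Qed.

Lemma vec3_eq2 x p q q' :
  forall j : 'I_3, j != 2%:R -> vec3 x p q 0 j = vec3 x p q' 0 j.
Proof. by move=> [[|[|[|//]]] lt_j]; rewrite !mxE. Qed.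

Ltac half_lra := try apply/halfE;
  rewrite ?/half_normal ?/half_bound /= ?dot_vec3 /half_ineqs; lra.

(** In the section, both moves stay in the facet of index 0. *)
Lemma linked_base p q : half_polytope (vec3 0 p q) ->
  linked half_boundary (vec3 0 p q) (vec3 0 0 0).
Proof.
move=> /halfE; rewrite /half_ineqs => h.
apply: (@linked_trans _ _ _ (vec3 0 p 0)).
  by apply: (@linked_in_facet 0%N isT 2%:R); [half_lra.. | exact: vec3_eq2].
by apply: (@linked_in_facet 0%N isT 1); [half_lra.. | exact: vec3_eq1].
Qed.

(** Half squares are parallel to the first axis and have an edge in the
    section. *)
Lemma linked_side x p q : half_polytope (vec3 x p q) ->
  [\/ p + q = 2, p - q = 2, - p + q = 2 | - p - q = 2] ->
  linked half_boundary (vec3 x p q) (vec3 0 0 0).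
Proof.
move=> /halfE; rewrite /half_ineqs => h side.
apply: linked_trans (linked_base (p := p) (q := q) _); last by half_lra.
case: side => side.
- by apply: (@linked_in_facet 6%N isT 0); [half_lra.. | exact: vec3_eq0].
- by apply: (@linked_in_facet 7%N isT 0); [half_lra.. | exact: vec3_eq0].
- by apply: (@linked_in_facet 8%N isT 0); [half_lra.. | exact: vec3_eq0].
- by apply: (@linked_in_facet 9%N isT 0); [half_lra.. | exact: vec3_eq0].
Qed.

(** A triangle is parallel to just one of the last two axes; moving along it
    ends on an edge shared with a half square. *)
Lemma linked_slanted x p q : half_polytope (vec3 x p q) ->
  [\/ x + p = 2, x - p = 2, x + q = 2 | x - q = 2] ->
  linked half_boundary (vec3 x p q) (vec3 0 0 0).
Proof.
move=> /halfE; rewrite /half_ineqs => h [] e.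
- apply: (@linked_trans _ _ _ (vec3 x p x)).
    by apply: (@linked_in_facet 2%N isT 2%:R); [half_lra.. | exact: vec3_eq2].
  by apply: linked_side; [half_lra | apply: Or41; lra].
- apply: (@linked_trans _ _ _ (vec3 x p x)).
    by apply: (@linked_in_facet 3%N isT 2%:R); [half_lra.. | exact: vec3_eq2].
  by apply: linked_side; [half_lra | apply: Or43; lra].
- apply: (@linked_trans _ _ _ (vec3 x x q)).
    by apply: (@linked_in_facet 4%N isT 1); [half_lra.. | exact: vec3_eq1].
  by apply: linked_side; [half_lra | apply: Or41; lra].
- apply: (@linked_trans _ _ _ (vec3 x x q)).
    by apply: (@linked_in_facet 5%N isT 1); [half_lra.. | exact: vec3_eq1].
  by apply: linked_side; [half_lra | apply: Or42; lra].
Qed.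

Lemma linked_top p q : half_polytope (vec3 1 p q) ->
  linked half_boundary (vec3 1 p q) (vec3 0 0 0).
Proof.
move=> /halfE; rewrite /half_ineqs => h.
apply: (@linked_trans _ _ _ (vec3 1 1 q)).
  by apply: (@linked_in_facet 1%N isT 1); [half_lra.. | exact: vec3_eq1].
by apply: linked_slanted; [half_lra | apply: Or41; lra].
Qed.

Lemma half_boundary_connected : orthogonally_connected half_boundary.
Proof.
apply: (@orthogonally_connected_root _ _ (vec3 0 0 0)) => v.
rewrite (vec3_eta v); move: (v 0 0) (v 0 1) (v 0 2%:R) => x p q.
move=> [[k k10] _ [h]]; move: h k k10.
move=> h [|[|[|[|[|[|[|[|[|[|//]]]]]]]]]] k10;
  rewrite /half_normal /half_bound/= dot_vec3 => e.
- have x0 : x = 0 by lra.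
  by move: h; rewrite x0; exact: linked_base.
- have x1 : x = 1 by lra.
  by move: h; rewrite x1; exact: linked_top.
- by apply: linked_slanted => //; apply: Or41; lra.
- by apply: linked_slanted => //; apply: Or42; lra.
- by apply: linked_slanted => //; apply: Or43; lra.
- by apply: linked_slanted => //; apply: Or44; lra.
- by apply: linked_side => //; apply: Or41; lra.
- by apply: linked_side => //; apply: Or42; lra.
- by apply: linked_side => //; apply: Or43; lra.
- by apply: linked_side => //; apply: Or44; lra.
Qed.

End HalfBoundary.

(** * The pieces *)

Section Pieces.
Variable R : realType.
Variables (a t : 'rV[R]_3).
Hypothesis a0 : forall i, a 0 i != 0.

Definition half_piece : set 'rV[R]_3 :=
  [set x *m diag_mx a + t | x in @half_polytope R].

Let unit_a : diag_mx a \in unitmx.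
Proof. by rewrite unitmxE det_diag unitfE; apply/prodf_neq0. Qed.

Lemma convex_polytope_half_piece : convex_polytope half_piece.
Proof.
apply: convex_polytope_affine; exists [set` half_vertices R].
by split; [exact: finite_seq | exact: half_conv_hull].
Qed.

Lemma decahedron_half_piece : decahedron half_piece.
Proof.
have [] := faces2_halfspaces_affine t unit_a (@half_normal_neq0 R)
  (@half_interior R) (@half_witnessP R).
by split=> //; exact: convex_polytope_half_piece.
Qed.

Lemma half_piece_boundary_connected :
  orthogonally_connected (boundary half_piece).
Proof.
rewrite /half_piece /half_polytope boundary_halfspaces_affine//; last first.
  exact: half_normal_neq0.
exact/orthogonally_connected_diag/half_boundary_connected.
Qed.

(** Both pieces of the decomposition share all but the sign of [a 0 0], so this
    separates their interiors. *)
Lemma interior_half_piece y : half_piece° y ->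
  exists2 l, 0 < l & y 0 0 = l * a 0 0 + t 0 0.
Proof.
rewrite /half_piece /half_polytope interior_halfspaces_affine//; last first.
  exact: half_normal_neq0.
move=> [x hx <-]; exists (x 0 0); last first.
  by rewrite mul_mx_diag !mxE.
have := hx (Ordinal (isT : (0 < 10)%N)).
rewrite [x in dot _ x]vec3_eta /half_normal /half_bound/= dot_vec3; lra.
Qed.

End Pieces.

(** * Cutting the standard cuboctahedron *)

Section CuboctahedronSplit.
Variable R : realType.
Implicit Types (x y z : R) (v : 'rV[R]_3).

(** The rotation by 45 degrees about the first axis, followed by a dilation of
    the orthogonal plane that makes all the entries integral. *)
Definition spiral : 'M[R]_3 :=
  \matrix_i [:: vec3 1 0 0; vec3 0 1 1; vec3 0 (-1) 1]`_i.

Lemma vec3_spiral x y z : vec3 x y z *m spiral = vec3 x (y - z) (y + z).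
Proof.
by apply/rowP => -[[|[|[|//]]] lt_i]; rewrite !mxE !big_ord_recr big_ord0/= !mxE
  /= ?mxE/=; ring.
Qed.

Lemma cuboctahedron_verticesP (a b : bool) :
  [/\ cuboctahedron_vertices (vec3 ((-1) ^+ a) ((-1) ^+ b) 0 : 'rV[R]_3),
      cuboctahedron_vertices (vec3 ((-1) ^+ a) 0 ((-1) ^+ b) : 'rV[R]_3) &
      cuboctahedron_vertices (vec3 0 ((-1) ^+ a) ((-1) ^+ b) : 'rV[R]_3)].
Proof.
split.
- exists 1%g, a, b; apply/rowP => i; rewrite !mxE perm1.
  by case: i => -[|[|[|//]]] lt_i.
- exists (tperm 1 2%:R), a, b; apply/rowP => i; rewrite !mxE.
  by case: i => -[|[|[|//]]] lt_i; rewrite permE/=.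
- exists (tperm 0 2%:R), b, a; apply/rowP => i; rewrite !mxE.
  by case: i => -[|[|[|//]]] lt_i; rewrite permE/=.
Qed.

(** The cuboctahedron itself. Written with norms, it is visibly invariant under
    permutations of the coordinates, as is the set of vertices. *)
Definition max_sum_norm_ball : set 'rV[R]_3 :=
  [set v | (forall i, `|v 0 i| <= 1) /\ \sum_i `|v 0 i| <= 2].

Lemma convex_max_sum_norm_ball : convex_set max_sum_norm_ball.
Proof.
apply/convex_setP => u v l /andP[l0 l1] [u1 u2] [v1 v2].
have l1' : 0 <= 1 - l by rewrite subr_ge0.
have tri i : `|(l *: u + (1 - l) *: v) 0 i| <=
    l * `|u 0 i| + (1 - l) * `|v 0 i|.
  rewrite !mxE; apply: le_trans (ler_normD _ _) _.
  by rewrite !normrM (ger0_norm l0) (ger0_norm l1').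
split=> [i|].
  apply: le_trans (tri i) _; have := ler_wpM2l l0 (u1 i).
  have := ler_wpM2l l1' (v1 i); lra.
apply: le_trans (ler_sum _ (fun i _ => tri i)) _.
rewrite big_split/= -!mulr_sumr; have := ler_wpM2l l0 u2.
have := ler_wpM2l l1' v2; lra.
Qed.

Lemma std_cuboctahedron_sub : @std_cuboctahedron R `<=` max_sum_norm_ball.
Proof.
apply: smallest_sub => [|_ [s [a [b ->]]]].
  exact: convex_max_sum_norm_ball.
split=> [i|]; rewrite ?mxE.
  by case: (s i) => -[|[|[|//]]] lt_i /=;
    rewrite ?normrX ?normrN1 ?expr1n ?normr0.
under eq_bigr do rewrite mxE.
rewrite -(reindex_inj (P := xpredT) (F := fun j =>
  `|(\row_j [:: (-1) ^+ a; (-1) ^+ b; 0]`_j : 'rV[R]_3) 0 j|) (@perm_inj _ s)).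
by rewrite !big_ord_recr big_ord0/= !mxE/= !normrX normrN1 !expr1n normr0; lra.
Qed.

(** The identity for index 0. *)
Definition reflection (i : 'I_2) : 'M[R]_3 :=
  diag_mx (vec3 ((-1) ^+ i) 1 1).

Lemma std_cuboctahedron_sub_halves v : @std_cuboctahedron R v ->
  (\bigcup_i [set u *m reflection i | u in @half_polytope R]) (v *m spiral).
Proof.
move=> /std_cuboctahedron_sub; rewrite (vec3_eta v).
move: (v 0 0) (v 0 1) (v 0 2%:R) => x y z [v1 v2]; rewrite vec3_spiral.
have [i xi] : exists i : 'I_2, x = `|x| * (-1) ^+ i.
  have [x0|x0] := ltrP x 0; [exists 1 | exists 0].
    by rewrite ltr0_norm// expr1; ring.
  by rewrite ger0_norm// expr0 mulr1.
exists i => //; exists (vec3 `|x| (y - z) (y + z)); last first.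
  by rewrite vec3_diag !mulr1 -xi.
apply/halfE; rewrite /half_ineqs.
have x1 : `|x| <= 1 by have := v1 0; rewrite mxE.
have y1 : `|y| <= 1 by have := v1 1; rewrite mxE.
have z1 : `|z| <= 1 by have := v1 2%:R; rewrite mxE.
move: v2; rewrite !big_ord_recr big_ord0/= !mxE/=.
have [yN zN] := (ler_norm (- y), ler_norm (- z)); rewrite !normrN in yN zN.
have := (normr_ge0 x, ler_norm y, ler_norm z) => -[[]]; lra.
Qed.

Lemma half_vertices_sub_cuboctahedron i u : u \in half_vertices R ->
  [set v *m spiral | v in @cuboctahedron_vertices R] (u *m reflection i).
Proof.
have V1 (b : bool) :
    [set v *m spiral | v in @cuboctahedron_vertices R]
      (vec3 ((-1) ^+ i) ((-1) ^+ b) ((-1) ^+ b)).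
  have [V _ _] := cuboctahedron_verticesP (odd i) b.
  eexists; first exact: V.
  by rewrite vec3_spiral signr_odd subr0 addr0.
have V2 (b : bool) :
    [set v *m spiral | v in @cuboctahedron_vertices R]
      (vec3 ((-1) ^+ i) (- (-1) ^+ b) ((-1) ^+ b)).
  have [_ V _] := cuboctahedron_verticesP (odd i) b.
  eexists; first exact: V.
  by rewrite vec3_spiral signr_odd sub0r add0r.
have V3 (a b : bool) :
    [set v *m spiral | v in @cuboctahedron_vertices R]
      (vec3 0 ((-1) ^+ a - (-1) ^+ b) ((-1) ^+ a + (-1) ^+ b)).
  have [_ _ V] := cuboctahedron_verticesP a b.
  by eexists; [exact: V | rewrite vec3_spiral].
rewrite !inE => /or4P[|||/or4P[|||/orP[]]] /eqP ->;
  rewrite vec3_diag ?mul0r ?mul1r ?mulr1.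
- by have := V3 false true; rewrite expr0 expr1 opprK subrr.
- by have := V3 true false; rewrite expr0 expr1 addNr -opprD.
- by have := V3 false false; rewrite expr0 subrr.
- by have := V3 true true; rewrite expr1 subrr -opprD.
- exact: (V1 false).
- by have := V2 true; rewrite expr1 opprK.
- exact: (V2 false).
- exact: (V1 true).
Qed.

Lemma std_cuboctahedron_halves :
  [set v *m spiral | v in @std_cuboctahedron R] =
  \bigcup_i [set u *m reflection i | u in @half_polytope R].
Proof.
apply/seteqP; split=> [_ [v hv <-]|].
  exact: std_cuboctahedron_sub_halves.
apply: bigcup_sub => i _; rewrite half_conv_hull -!conv_hull_linear.
apply: sub_smallest2r; first exact: conv_hull_convex.
by move=> _ [u hu <-]; exact: half_vertices_sub_cuboctahedron.
Qed.

End CuboctahedronSplit.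

(** * Rotations *)

Lemma orthogonal_mul (R : realType) (M N : 'M[R]_3) :
  orthogonal_mx M -> orthogonal_mx N -> orthogonal_mx (M *m N).
Proof.
by move=> oM oN; rewrite /orthogonal_mx trmx_mul mulmxA -(mulmxA M) oN mulmx1.
Qed.

Lemma orthogonal_tr (R : realType) (M : 'M[R]_3) :
  orthogonal_mx M -> orthogonal_mx M^T.
Proof. by rewrite /orthogonal_mx trmxK => /mulmx1C. Qed.

Lemma orthogonal_det_sqr (R : realType) (M : 'M[R]_3) :
  orthogonal_mx M -> \det M * \det M = 1.
Proof. by move=> oM; rewrite -[X in _ * X]det_tr -det_mulmx oM det1. Qed.

(** The determinant is 1 or -1, and in odd dimension changing the sign of a
    matrix changes the sign of its determinant. *)
Lemma rotation_det_scale (R : realType) (M : 'M[R]_3) :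
  orthogonal_mx M -> rotation (\det M *: M).
Proof.
move=> oM; have dd := orthogonal_det_sqr oM; split.
  by rewrite /orthogonal_mx linearZ/= -scalemxAl -scalemxAr oM scalerA dd
    scale1r.
by rewrite detZ !exprS expr0 mulr1 -!mulrA dd mulr1 dd.
Qed.

Lemma sqrt2V_sqr (R : realType) : (Num.sqrt (2 : R))^-1 ^+ 2 = 2^-1.
Proof. by rewrite exprVn sqr_sqrtr. Qed.

Definition turn45 (R : realType) : 'M[R]_3 :=
  spiral R *m diag_mx (vec3 1 (Num.sqrt 2)^-1 (Num.sqrt 2)^-1).

Lemma orthogonal_turn45 (R : realType) : orthogonal_mx (turn45 R).
Proof.
have h := sqrt2V_sqr R; rewrite /orthogonal_mx /turn45.
set r := (Num.sqrt 2)^-1 in h *; apply/matrixP => i j.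
rewrite mul_mx_diag !mxE !big_ord_recr big_ord0/= !mxE/=.
by case: i => -[|[|[|//]]] lt_i; case: j => -[|[|[|//]]] lt_j;
  rewrite !mxE/=; lra.
Qed.

(** * Decomposition of an arbitrary cuboctahedron *)

Theorem theorem5p3 (R : realType) (C : set 'rV[R]_3)
    (hC : is_cuboctahedron C) :
  exists M : 'M[R]_3, rotation M /\
  exists Q : 'I_2 -> set 'rV[R]_3,
    decomposed [set x *m M | x in C] Q /\
    forall i, decahedron (Q i) /\ orthogonally_connected (boundary (Q i)).
Proof.
have [k [M0 [t [k0 oM0 ->]]]] := hC.
(* undo the placement, then turn by 45 degrees *)
pose M1 := M0^T *m turn45 R.
have oM1 : orthogonal_mx M1.
  by apply: orthogonal_mul; [exact: orthogonal_tr | exact: orthogonal_turn45].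
pose M := \det M1 *: M1; exists M; split; first exact: rotation_det_scale.
(* [c] is the signed homothety ratio *)
pose c := \det M1 * k; pose r := c * (Num.sqrt 2)^-1.
have c0 : c != 0.
  apply: mulf_neq0; last by rewrite gt_eqF.
  apply/eqP => d0.
  by have := orthogonal_det_sqr oM1; rewrite d0 mul0r => /esym/eqP;
    rewrite oner_eq0.
have r0 : r != 0 by rewrite mulf_neq0// invr_eq0 sqrtr_eq0 -ltNge.
pose a (i : 'I_2) := vec3 ((-1) ^+ i * c) r r.
have a0 i j : a i 0 j != 0.
  case: j => -[|[|[|//]]] lt_j; rewrite mxE//=.
  by apply: mulf_neq0; rewrite // signr_eq0.
pose Q i := half_piece (a i) (t *m M); exists Q.
have QE : [set x *m M | x in
    [set k *: (x *m M0) + t | x in @std_cuboctahedron R]] = \bigcup_i Q i.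
  have step v : (k *: (v *m M0) + t) *m M =
      v *m spiral R *m diag_mx (vec3 c r r) + t *m M.
    have vM1 : v *m M0 *m M1 = v *m turn45 R.
      by rewrite /M1 mulmxA -(mulmxA v) oM0 mulmx1.
    rewrite mulmxDl; congr (_ + _).
    rewrite -scalemxAl /M -scalemxAr scalerA vM1 [k * _]mulrC -/c /turn45.
    rewrite mulmxA scalemxAr; congr (_ *m _).
    rewrite -linearZ/= ; congr diag_mx.
    by rewrite vec3Z mulr1.
  rewrite image_comp /comp; under eq_imagel do rewrite step.
  rewrite -(image_comp (fun v => v *m spiral R)
    (fun v => v *m diag_mx (vec3 c r r) + t *m M)).
  rewrite std_cuboctahedron_halves image_bigcup; apply: eq_bigcupr => i _.
  rewrite image_comp; apply: eq_imagel => v _ /=.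
  rewrite -mulmxA; congr (_ *m _ + _).
  rewrite mul_diag_mx; apply/matrixP => j l; rewrite !mxE mulrnAr.
  by case: j => -[|[|[|//]]] lt_j; rewrite ?mul1r.
split; last first.
  by move=> i; split; [exact: decahedron_half_piece
                      | exact: half_piece_boundary_connected].
split=> //; first by move=> i; exact: convex_polytope_half_piece.
have disj : (Q 0)° `&` (Q 1)° = set0.
  rewrite -subset0 => y [/(interior_half_piece (a0 0))[l l0 yl]].
  move=> /(interior_half_piece (a0 1))[m m0]; rewrite {}yl.
  rewrite !mxE/= expr0 expr1 mul1r mulN1r => /addIr /eqP.
  rewrite mulrN -subr_eq0 opprK -mulrDl mulf_eq0 (negbTE c0) orbF gt_eqF//.
  exact: addr_gt0.
have cases2 (i : 'I_2) : i = 0 \/ i = 1.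
  by case: i => -[|[|//]] lt_i; [left | right]; exact: val_inj.
apply/trivIsetP => i j _ _ /=.
by have [->|->] := cases2 i; have [->|->] := cases2 j; rewrite ?eqxx// 1?setIC.
Qed.
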